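(* For every $1\le p<\infty$, the quotient Banach algebra $B(\ell^p)/K(\ell^p)$ fails the ball-covering property, and $B(c_0)/K(c_0)$ fails the ball-covering property.
   Context: For a Banach space $X$, $B(X)$ is the space of bounded linear operators on $X$ with the operator norm, $K(X)$ the ideal of compact operators, and $B(X)/K(X)$ carries the quotient norm. A normed space $Y$ with unit sphere $S_Y$ has the ball-covering property (BCP) if there is a sequence of open balls $(B(y_n,r_n))_{n=1}^\infty$ in $Y$ with $S_Y\subseteq\bigcup_{n=1}^\infty B(y_n,r_n)$ and $0\notin B(y_n,r_n)$ for every $n$; it fails the BCP if it does not have it. *)

(* Defs.v *)
From HB Require Import structures.
From mathcomp Require Import all_boot all_order all_algebra ring_quotient.
From mathcomp Require Import complex ring.
From mathcomp Require Import all_classical all_reals all_analysis.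

Set Implicit Arguments.
Unset Strict Implicit.
Unset Printing Implicit Defensive.
Import Order.TTheory GRing.Theory Num.Theory.
Import numFieldNormedType.Exports.
Local Open Scope classical_set_scope.
Local Open Scope ring_scope.

(* A complete valued field extending R with its usual absolute value; the
   instances below are R itself and R[i]. Norms of a normedModType K live in
   K, so [of_real] and [modulus] are used to move them from and to R. *)
HB.mixin Record NumField_isScalar (R : realType) K & Num.NumField K := {
  of_real : R -> K ;
  modulus : K -> R ;
  of_realB : forall r s : R, of_real (r - s) = of_real r - of_real s ;
  of_realM : forall r s : R, of_real (r * s) = of_real r * of_real s ;
  of_real1 : of_real 1 = 1 ;
  ler_of_real : forall r s : R, (of_real r <= of_real s) = (r <= s) ;
  normE : forall a : K, `|a| = of_real (modulus a) ;
  modulus_complete : forall u : nat -> K,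
    (forall e : R, 0 < e -> exists N, forall m n, (N <= m)%N -> (N <= n)%N ->
      modulus (u m - u n) < e) ->
    exists l, forall e : R, 0 < e -> exists N, forall n, (N <= n)%N ->
      modulus (u n - l) < e
}.

#[short(type="scalarFieldType")]
HB.structure Definition ScalarField (R : realType) :=
  {K of Num.NumField K & NumField_isScalar R K}.

Section RealScalar.
Variable R : realType.

Lemma real_modulus_complete (u : nat -> R) :
  (forall e : R, 0 < e -> exists N, forall m n, (N <= m)%N -> (N <= n)%N ->
    `|u m - u n| < e) ->
  exists l, forall e : R, 0 < e -> exists N, forall n, (N <= n)%N ->
    `|u n - l| < e.
Proof.
move=> cu.
have /R_complete : cauchy (u @ \oo).
  apply/cauchyP => e e0; have [N uN] := cu _ e0.
  by exists (u N), N => // n /= Nn; apply: uN.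
move=> /cvg_ex[l ul]; exists l => e e0.
have /cvgrPdist_lt /(_ _ e0)[N _ uN] := ul.
by exists N => n Nn; rewrite distrC; apply: uN.
Qed.

HB.instance Definition _ := @NumField_isScalar.Build R R id Num.norm
  (fun _ _ => erefl) (fun _ _ => erefl) erefl (fun _ _ => erefl)
  (fun _ => erefl) real_modulus_complete.

Lemma complex_modulus_complete (u : nat -> R[i]) :
  (forall e : R, 0 < e -> exists N, forall m n, (N <= m)%N -> (N <= n)%N ->
    Normc.normc (u m - u n) < e) ->
  exists l, forall e : R, 0 < e -> exists N, forall n, (N <= n)%N ->
    Normc.normc (u n - l) < e.
Proof.
have ReN (z : R[i]) : `|complex.Re z| <= Normc.normc z.
  case: z => a b /=; rewrite -sqrtr_sqr ler_sqrt ?addr_ge0 ?sqr_ge0//.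
  by rewrite lerDl sqr_ge0.
have ImN (z : R[i]) : `|complex.Im z| <= Normc.normc z.
  case: z => a b /=; rewrite -sqrtr_sqr ler_sqrt ?addr_ge0 ?sqr_ge0//.
  by rewrite lerDr sqr_ge0.
have le_N (z : R[i]) : Normc.normc z <= `|complex.Re z| + `|complex.Im z|.
  case: z => a b /=; rewrite -[leRHS]ger0_norm ?addr_ge0// -sqrtr_sqr.
  rewrite ler_sqrt ?sqr_ge0// sqrrD !real_normK ?num_real// lerD2r lerDl.
  by rewrite mulrn_wge0// mulr_ge0.
move=> cu.
have [|a ua] := @real_modulus_complete (fun n => complex.Re (u n)).
  move=> e /cu[N uN]; exists N => m n Nm Nn; apply: le_lt_trans (uN _ _ Nm Nn).
  by move: (u m) (u n) => [? ?] [? ?] /=; exact: ReN (_ +i* _)%C.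
have [|b ub] := @real_modulus_complete (fun n => complex.Im (u n)).
  move=> e /cu[N uN]; exists N => m n Nm Nn; apply: le_lt_trans (uN _ _ Nm Nn).
  by move: (u m) (u n) => [? ?] [? ?] /=; exact: ImN (_ +i* _)%C.
exists (a +i* b)%C => e e0.
have e2 : 0 < e / 2 by rewrite divr_gt0.
have [N uN] := ua _ e2; have [M uM] := ub _ e2.
exists (maxn N M) => n; rewrite geq_max => /andP[Nn Mn].
apply: (le_lt_trans (le_N _)); rewrite [e]splitr ltrD//.
  by move: (uN _ Nn); case: (u n).
by move: (uM _ Mn); case: (u n).
Qed.

HB.instance Definition _ := @NumField_isScalar.Build R R[i]
  (real_complex R) (@Normc.normc R) (rmorphB _) (rmorphM _) (rmorph1 _)
  (@lecR R) (fun _ => erefl) complex_modulus_complete.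

End RealScalar.

Section ScalarTheory.
Variables (R : realType) (K : scalarFieldType R).
Implicit Types (a b : K) (r s : R).
Local Notation iota := (@of_real R K).
Local Notation modulus := (@modulus R K).

Fact of_real_is_zmod_morphism : zmod_morphism iota.
Proof. exact: of_realB. Qed.

Fact of_real_is_monoid_morphism : monoid_morphism iota.
Proof. by split; [exact: of_real1|exact: of_realM]. Qed.

HB.instance Definition _ := GRing.isZmodMorphism.Build R K iota
  of_real_is_zmod_morphism.
HB.instance Definition _ := GRing.isMonoidMorphism.Build R K iota
  of_real_is_monoid_morphism.

Lemma of_real0 : iota 0 = 0. Proof. exact: rmorph0. Qed.

Lemma of_realD r s : iota (r + s) = iota r + iota s.
Proof. exact: rmorphD. Qed.

Lemma of_real_inj : injective iota.
Proof. exact: fmorph_inj. Qed.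

Lemma ltr_of_real : {mono iota : x y / x < y}.
Proof. by move=> x y; rewrite !lt_neqAle ler_of_real (inj_eq of_real_inj). Qed.

Lemma of_real_ge0 r : (0 <= iota r) = (0 <= r).
Proof. by rewrite -of_real0 ler_of_real. Qed.

Lemma of_real_gt0 r : (0 < iota r) = (0 < r).
Proof. by rewrite -of_real0 ltr_of_real. Qed.

Lemma modulus_of_real r : 0 <= r -> modulus (iota r) = r.
Proof.
by move=> r0; apply: of_real_inj; rewrite -normE ger0_norm// of_real_ge0.
Qed.

Lemma of_real_modulus a : 0 <= a -> iota (modulus a) = a.
Proof. by move=> a0; rewrite -normE ger0_norm. Qed.

Lemma modulus_ge0 a : 0 <= modulus a.
Proof. by rewrite -of_real_ge0 -normE. Qed.

Lemma modulus_eq0 a : (modulus a == 0) = (a == 0).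
Proof. by rewrite -(inj_eq of_real_inj) -normE of_real0 normr_eq0. Qed.

Lemma modulus0 : modulus 0 = 0.
Proof. by apply/eqP; rewrite modulus_eq0. Qed.

Lemma modulus1 : modulus 1 = 1.
Proof. by rewrite -(of_real1 (s := K)) modulus_of_real. Qed.

Lemma modulusM a b : modulus (a * b) = modulus a * modulus b.
Proof. by apply: of_real_inj; rewrite of_realM -!normE normrM. Qed.

Lemma modulusN a : modulus (- a) = modulus a.
Proof. by apply: of_real_inj; rewrite -!normE normrN. Qed.

Lemma modulusB a b : modulus (a - b) = modulus (b - a).
Proof. by rewrite -modulusN opprB. Qed.

Lemma ler_modulusD a b : modulus (a + b) <= modulus a + modulus b.
Proof. by rewrite -(ler_of_real (s := K)) of_realD -!normE ler_normD. Qed.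

Lemma ler_modulus a b : 0 <= a -> a <= b -> modulus a <= modulus b.
Proof.
by move=> a0 ab; rewrite -(ler_of_real (s := K)) !of_real_modulus// (le_trans a0).
Qed.

Lemma ge0_normZ (M : lmodType K) (N : M -> R) : (forall x, 0 <= N x) ->
  (forall a x, N (a *: x) <= modulus a * N x) ->
  forall a x, N (a *: x) = modulus a * N x.
Proof.
move=> N0 NZ a x; apply/eqP; rewrite eq_le NZ/=.
have [->|a0] := eqVneq a 0; first by rewrite modulus0 mul0r N0.
have ma0 : 0 < modulus a by rewrite lt_neqAle eq_sym modulus_eq0 a0 modulus_ge0.
rewrite -ler_pdivlMl// -[X in N X <= _](@scalerK _ _ a)//.
apply: le_trans (NZ _ _) _; rewrite ler_wpM2r//.
by rewrite -[leRHS]mul1r -modulus1 -(mulVf a0) modulusM mulfK// gt_eqF.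
Qed.

Section RealNorm.
Variables (M : lmodType K) (N : M -> R).
Hypothesis ND : forall x y, N (x + y) <= N x + N y.
Hypothesis NZ : forall a x, N (a *: x) = modulus a * N x.
Hypothesis N0 : forall x, N x = 0 -> x = 0.

Lemma ler_of_realD x y : iota (N (x + y)) <= iota (N x) + iota (N y).
Proof. by rewrite -of_realD ler_of_real. Qed.

Lemma of_realZ a x : iota (N (a *: x)) = `|a| * iota (N x).
Proof. by rewrite NZ of_realM normE. Qed.

Lemma of_real_eq0 x : iota (N x) = 0 -> x = 0.
Proof. by move=> /eqP; rewrite fmorph_eq0 => /eqP/N0. Qed.

End RealNorm.

Section NormedSpace.
Variable V : normedModType K.
Implicit Types x y : V.

(* The norm of a K-normed space, seen in R. *)
Definition rnorm x : R := modulus `|x|.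

Lemma rnormE x : `|x| = iota (rnorm x).
Proof. by rewrite of_real_modulus. Qed.

Lemma rnorm_ge0 x : 0 <= rnorm x.
Proof. exact: modulus_ge0. Qed.

Lemma rnorm0 : rnorm 0 = 0.
Proof. by rewrite /rnorm normr0 modulus0. Qed.

Lemma rnorm_eq0 x : (rnorm x == 0) = (x == 0).
Proof. by rewrite modulus_eq0 normr_eq0. Qed.

Lemma rnormD x y : rnorm (x + y) <= rnorm x + rnorm y.
Proof. by rewrite -(ler_of_real (s := K)) of_realD -!rnormE ler_normD. Qed.

Lemma rnormZ a x : rnorm (a *: x) = modulus a * rnorm x.
Proof.
rewrite /rnorm normrZ modulusM; congr (_ * _).
by rewrite normE modulus_of_real// modulus_ge0.
Qed.

Lemma rnormN x : rnorm (- x) = rnorm x.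
Proof. by rewrite /rnorm normrN. Qed.

Lemma rnormB x y : rnorm (x - y) = rnorm (y - x).
Proof. by rewrite -rnormN opprB. Qed.

Lemma rnorm_le1 x : (`|x| <= 1) = (rnorm x <= 1).
Proof. by rewrite rnormE -(of_real1 (s := K)) ler_of_real. Qed.

Lemma rnorm_ball x y (r : R) : ball x (iota r) y <-> rnorm (x - y) < r.
Proof. by rewrite -ball_normE /ball_/= rnormE ltr_of_real. Qed.

Lemma nbhs_rnorm x (A : set V) :
  nbhs x A <-> exists2 r : R, 0 < r & forall y, rnorm (x - y) < r -> A y.
Proof.
split=> [/nbhs_ballP[e /= e0 xeA]|[r r0 rA]].
  exists (modulus e); first by rewrite -of_real_gt0 of_real_modulus// ltW.
  move=> y xy; apply: xeA; rewrite -(of_real_modulus (ltW e0)).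
  exact/rnorm_ball.
apply/nbhs_ballP; exists (iota r); rewrite /= ?of_real_gt0// => y /rnorm_ball.
exact: rA.
Qed.

Definition rcauchy (u : nat -> V) := forall e : R, 0 < e ->
  exists N, forall m n, (N <= m)%N -> (N <= n)%N -> rnorm (u m - u n) < e.

Definition rcvg (u : nat -> V) l := forall e : R, 0 < e ->
  exists N, forall n, (N <= n)%N -> rnorm (u n - l) < e.

Lemma rcauchy_complete : (forall u, rcauchy u -> exists l, rcvg u l) ->
  forall F : set_system V, ProperFilter F -> cauchy F -> cvg F.
Proof.
move=> cV F FF cF.
have small (n : nat) : exists x, F [set y | rnorm (x - y) < n.+1%:R^-1].
  have /cauchyP/(_ (iota n.+1%:R^-1)) := cF.
  rewrite of_real_gt0 invr_gt0 ltr0n => /(_ isT)[x Fx]; exists x.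
  by apply: filterS Fx => y /= /rnorm_ball.
pose x n := projT1 (cid (small n)).
have Fx n : F [set y | rnorm (x n - y) < n.+1%:R^-1] := projT2 (cid (small n)).
have arch (e : R) : 0 < e -> exists N, forall n, (N <= n)%N -> n.+1%:R^-1 < e.
  move=> e0; have [N _ NP] := near_infty_natSinv_lt (PosNum e0).
  by exists N => n Nn; exact: NP.
have [e e0|l xl] := cV x.
  have [N NP] := arch _ (divr_gt0 e0 (ltr0Sn _ 1)).
  exists N => m n Nm Nn.
  have [z [/= xmz xnz]] := filter_ex (filterI (Fx m) (Fx n)).
  have -> : x m - x n = (x m - z) + (z - x n) by rewrite addrA subrK.
  apply: (le_lt_trans (rnormD _ _)); rewrite [e]splitr ltrD//.
    exact: lt_trans (NP _ Nm).
  by rewrite rnormB; exact: lt_trans (NP _ Nn).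
apply/cvg_ex; exists l => A /nbhs_rnorm[e e0 eA].
have [N NP] := arch _ (divr_gt0 e0 (ltr0Sn _ 1)).
have [M MP] := xl _ (divr_gt0 e0 (ltr0Sn _ 1)).
apply: filterS (Fx (maxn N M)) => y /= xy; apply: eA.
have -> : l - y = (l - x (maxn N M)) + (x (maxn N M) - y) by rewrite addrA subrK.
apply: (le_lt_trans (rnormD _ _)); rewrite [e]splitr ltrD//.
  by rewrite rnormB MP// leq_maxr.
by apply: lt_trans xy _; rewrite NP// leq_maxl.
Qed.

End NormedSpace.
End ScalarTheory.

Section Ellp.
Variables (R : realType) (K : scalarFieldType R) (p : R).
Implicit Types (x y : nat -> K^o) (C D : R).

Definition pseries x : R^nat := series (fun k => modulus (x k) `^ p).

Definition ellp_pred (p1 : 1 <= p) : {pred nat -> K^o} :=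
  fun x => `[< cvgn (pseries x) >].

Definition pnorm x : R := limn (pseries x) `^ p^-1.

Hypothesis p1 : 1 <= p.

Let p0 : 0 < p. Proof. exact: lt_le_trans p1. Qed.
Let pn0 : p != 0. Proof. by rewrite gt_eqF. Qed.

Let powR_leV (a b : R) : 0 <= a -> 0 <= b -> a <= b -> a `^ p^-1 <= b `^ p^-1.
Proof.
by move=> a0 b0 ab; rewrite ge0_ler_powR ?nnegrE ?invr_ge0 ?(ltW p0).
Qed.

Let powRVK (a : R) : 0 <= a -> (a `^ p) `^ p^-1 = a.
Proof. by move=> a0; rewrite -powRrM mulfV// powRr1. Qed.

Lemma pseries_nondecreasing x : nondecreasing_seq (pseries x).
Proof. by apply: nondecreasing_series => k _ _; rewrite powR_ge0. Qed.

Lemma pseries_ge0 x n : 0 <= pseries x n.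
Proof. by apply: sumr_ge0 => k _; rewrite powR_ge0. Qed.

Lemma ellp_bounded x C : (forall n, pseries x n <= C) -> x \in ellp_pred p1.
Proof.
move=> xC; apply/asboolP; apply: nondecreasing_is_cvgn.
  exact: pseries_nondecreasing.
by exists C => _ [n _ <-].
Qed.

Lemma pseries_le_lim x n : x \in ellp_pred p1 -> pseries x n <= limn (pseries x).
Proof.
by move=> /asboolP cx; exact: nondecreasing_cvgn_le (@pseries_nondecreasing x) cx n.
Qed.

Lemma powR_pnorm x : x \in ellp_pred p1 -> pnorm x `^ p = limn (pseries x).
Proof.
move=> xp; rewrite /pnorm -powRrM mulVf// powRr1//.
by apply: le_trans (pseries_le_lim 0 xp); exact: pseries_ge0.
Qed.

Lemma pnorm_ge0 x : 0 <= pnorm x.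
Proof. exact: powR_ge0. Qed.

Lemma pseries_le x n : x \in ellp_pred p1 -> pseries x n <= pnorm x `^ p.
Proof. by move=> xp; rewrite powR_pnorm// pseries_le_lim. Qed.

Lemma pnorm_le x C : 0 <= C -> (forall n, pseries x n <= C `^ p) -> pnorm x <= C.
Proof.
move=> C0 xC; have /asboolP cx := ellp_bounded xC.
have : limn (pseries x) <= C `^ p.
  by apply: limr_le => //; apply: nearW.
have lim0 : 0 <= limn (pseries x).
  by apply: le_trans (pseries_le_lim 0 (ellp_bounded xC)); exact: pseries_ge0.
move=> /(powR_leV lim0 (powR_ge0 _ _)).
by rewrite (powRVK C0).
Qed.

Lemma pnorm_coord x k : x \in ellp_pred p1 -> modulus (x k) <= pnorm x.
Proof.
move=> xp; have : modulus (x k) `^ p <= pnorm x `^ p.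
  apply: le_trans (pseries_le k.+1 xp); rewrite /pseries seriesEnat/= big_nat_recr//=.
  by rewrite lerDr sumr_ge0// => i _; rewrite powR_ge0.
move=> /(powR_leV (powR_ge0 _ _) (powR_ge0 _ _)).
by rewrite (powRVK (modulus_ge0 _)) (powRVK (pnorm_ge0 x)).
Qed.

Lemma pseriesD x y C D n : 0 < C -> 0 < D ->
  pseries x n <= C `^ p -> pseries y n <= D `^ p ->
  pseries (x + y) n <= (C + D) `^ p.
Proof.
move=> C0 D0 xC yD; have CD0 : 0 < C + D by rewrite addr_gt0.
pose t := C / (C + D).
have t01 : 0 <= t <= 1.
  rewrite divr_ge0 ?(ltW C0) ?(ltW CD0)//=.
  by rewrite ler_pdivrMr// mul1r lerDl (ltW D0).
have Et : 1 - t = D / (C + D) by rewrite /t; field; rewrite gt_eqF.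
have powdiv (a b : R) : 0 <= a -> 0 < b -> (a / b) `^ p = a `^ p / b `^ p.
  move=> a0 b0; have bp0 : b `^ p != 0 by rewrite gt_eqF ?powR_gt0.
  apply: (mulIf bp0); rewrite divfK// -powRM ?(divr_ge0 a0) ?(ltW b0)//.
  by rewrite divfK// gt_eqF.
have main k : modulus ((x + y) k) `^ p <= (C + D) `^ p *
    (t / C `^ p * modulus (x k) `^ p + (1 - t) / D `^ p * modulus (y k) `^ p).
  set a := modulus (x k); set b := modulus (y k).
  have a0 : 0 <= a by exact: modulus_ge0.
  have b0 : 0 <= b by exact: modulus_ge0.
  apply: (@le_trans _ _ ((a + b) `^ p)).
    rewrite ge0_ler_powR ?nnegrE ?modulus_ge0 ?addr_ge0 ?(ltW p0)//.
    exact: ler_modulusD.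
  have -> : a + b = (C + D) * (t * (a / C) + (1 - t) * (b / D)).
    by rewrite Et /t; field; rewrite !gt_eqF.
  have aC : 0 <= a / C by rewrite divr_ge0// ltW.
  have bD : 0 <= b / D by rewrite divr_ge0// ltW.
  have t0 : 0 <= t by case/andP: t01.
  have t1 : 0 <= 1 - t by rewrite subr_ge0; case/andP: t01.
  have cvx0 : 0 <= t * (a / C) + (1 - t) * (b / D).
    by rewrite addr_ge0// mulr_ge0.
  rewrite (powRM _ (ltW CD0) cvx0) ler_wpM2l ?powR_ge0//.
  have inR (z : R) : 0 <= z -> z \in (`[0, +oo[%classic : set R).
    by move=> z0; rewrite inE/= in_itv/= z0.
  have /le_trans : (t * (a / C) + (1 - t) * (b / D)) `^ p <=
      t * (a / C) `^ p + (1 - t) * (b / D) `^ p.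
    exact: (@convex_powR _ _ p1 (Itv01 t0 (proj2 (andP t01))) _ _
      (inR _ aC) (inR _ bD)).
  apply; rewrite !powdiv// le_eqVlt; apply/orP; left; apply/eqP.
  by rewrite !mulrA [_ * a `^ p * _]mulrAC [_ * b `^ p * _]mulrAC.
have : \sum_(k < n) modulus ((x + y) k) `^ p <= \sum_(k < n) (C + D) `^ p *
    (t / C `^ p * modulus (x k) `^ p + (1 - t) / D `^ p * modulus (y k) `^ p).
  by apply: ler_sum => k _; exact: main.
rewrite -mulr_sumr big_split/= -!mulr_sumr.
rewrite /pseries !seriesEord/= in xC yD *.
move=> /le_trans; apply; rewrite -[leRHS]mulr1 ler_wpM2l ?powR_ge0//.
have tC0 : 0 <= t / C `^ p by rewrite divr_ge0 ?powR_ge0//; case/andP: t01.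
have tD0 : 0 <= (1 - t) / D `^ p.
  by rewrite divr_ge0 ?powR_ge0// subr_ge0; case/andP: t01.
have := lerD (ler_wpM2l tC0 xC) (ler_wpM2l tD0 yD).
rewrite !divfK ?gt_eqF ?powR_gt0// => /le_trans; apply.
by rewrite addrC subrK.
Qed.

Lemma pseriesZ (a : K) x n : pseries (a *: x) n = modulus a `^ p * pseries x n.
Proof.
rewrite /pseries !seriesEord/= mulr_sumr; apply: eq_bigr => k _.
by rewrite modulusM powRM// modulus_ge0.
Qed.

Lemma pseries_lt_add x n e : x \in ellp_pred p1 -> 0 < e ->
  pseries x n <= (pnorm x + e) `^ p.
Proof.
move=> xp e0; apply: le_trans (pseries_le n xp) _.
by rewrite ge0_ler_powR ?nnegrE ?addr_ge0 ?pnorm_ge0 ?(ltW p0) ?(ltW e0)// lerDl (ltW e0).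
Qed.

Lemma pnorm_gt x e : 0 < e -> 0 < pnorm x + e.
Proof. by move=> e0; rewrite ltr_wpDl// pnorm_ge0. Qed.

Fact ellp_submod_closed : submod_closed (ellp_pred p1).
Proof.
split=> [|a x y xp yp].
  apply: (@ellp_bounded _ 0) => n; rewrite /pseries seriesEord/= big1// => k _.
  by rewrite modulus0 powR0.
have axp : a *: x \in ellp_pred p1.
  apply: (@ellp_bounded _ (modulus a `^ p * pnorm x `^ p)) => n.
  by rewrite pseriesZ ler_wpM2l ?powR_ge0 ?pseries_le.
apply: (@ellp_bounded _ ((pnorm (a *: x) + 1 + (pnorm y + 1)) `^ p)) => n.
by apply: pseriesD; rewrite ?pnorm_gt ?pseries_lt_add.
Qed.

HB.instance Definition _ :=
  GRing.isSubmodClosed.Build K (nat -> K^o) (ellp_pred p1) ellp_submod_closed.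

Record ellp := Ellp { ellp_val :> nat -> K^o ; _ : ellp_val \in ellp_pred p1 }.

HB.instance Definition _ := [isSub for ellp_val].
HB.instance Definition _ := [Choice of ellp by <:].
HB.instance Definition _ := [SubChoice_isSubLmodule of ellp by <:].

Lemma ellp_valP (x : ellp) : (x : nat -> K^o) \in ellp_pred p1.
Proof. exact: valP. Qed.

Definition ellp_norm (x : ellp) : R := pnorm x.

Lemma ler_ellp_normD (x y : ellp) :
  ellp_norm (x + y) <= ellp_norm x + ellp_norm y.
Proof.
apply/ler_addgt0Pr => e e0.
have e2 : 0 < e / 2 by rewrite divr_gt0.
have -> : ellp_norm x + ellp_norm y + e
    = (ellp_norm x + e / 2) + (ellp_norm y + e / 2).
  by rewrite addrACA -splitr.
apply: pnorm_le => [|n]; first by rewrite addr_ge0// addr_ge0 ?pnorm_ge0 ?(ltW e2).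
apply: pseriesD; rewrite ?pnorm_gt//; apply: pseries_lt_add => //;
  exact: ellp_valP.
Qed.

Lemma ellp_normZ (a : K) (x : ellp) :
  ellp_norm (a *: x) = modulus a * ellp_norm x.
Proof.
apply: (@ge0_normZ _ K _ ellp_norm) => [y|b y]; first exact: pnorm_ge0.
apply: pnorm_le => [|n]; first by rewrite mulr_ge0 ?modulus_ge0 ?pnorm_ge0.
rewrite powRM ?modulus_ge0 ?pnorm_ge0// pseriesZ ler_wpM2l ?powR_ge0//.
exact/pseries_le/ellp_valP.
Qed.

Lemma ellp_norm0_eq0 (x : ellp) : ellp_norm x = 0 -> x = 0.
Proof.
move=> x0; apply/val_inj/funext => k; apply/eqP.
rewrite -(@modulus_eq0 _ K) eq_le modulus_ge0 andbT -x0 pnorm_coord//.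
exact: ellp_valP.
Qed.

HB.instance Definition _ := Lmodule_isNormed.Build K ellp
  (ler_of_realD (K := K) ler_ellp_normD) (of_realZ ellp_normZ)
  (of_real_eq0 ellp_norm0_eq0).

Lemma ellp_normE (x : ellp) : `|x| = of_real (pnorm x).
Proof. by []. Qed.

Lemma ellp_rnormE (x : ellp) : rnorm x = pnorm x.
Proof. by rewrite /rnorm modulus_of_real// pnorm_ge0. Qed.

Lemma pseries_le_sum x n C :
  \sum_(k < n) modulus (x k) <= C -> 0 < C -> pseries x n <= C `^ p.
Proof.
move=> xC C0; rewrite /pseries seriesEord/=.
have -> : C `^ p = C * C `^ (p - 1).
  by rewrite mulr_powRB1// ltW.
apply: (@le_trans _ _ (\sum_(k < n) modulus (x k) * C `^ (p - 1))); last first.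
  by rewrite -mulr_suml ler_wpM2r ?powR_ge0.
apply: ler_sum => k _; set a := modulus (x k).
have a0 : 0 <= a by exact: modulus_ge0.
have aC : a <= C.
  apply: le_trans xC; rewrite (bigD1 k)//= lerDl sumr_ge0// => i _.
  exact: modulus_ge0.
by rewrite -mulr_powRB1// ler_wpM2l// ge0_ler_powR ?nnegrE ?subr_ge0// (ltW C0).
Qed.

Lemma ellp_seq_complete (u : nat -> ellp) : rcauchy u -> exists l, rcvg u l.
Proof.
move=> cu.
have ck k : exists l : K, forall e : R, 0 < e -> exists N, forall n, (N <= n)%N ->
    modulus (u n k - l) < e.
  apply: (@modulus_complete _ K (fun n => u n k)) => e /cu[N uN].
  exists N => m n Nm Nn; apply: le_lt_trans (uN _ _ Nm Nn).
  by rewrite ellp_rnormE (pnorm_coord k (ellp_valP (u m - u n))).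
pose l k : K^o := projT1 (cid (ck k)).
have ul k := projT2 (cid (ck k)) : forall e : R, 0 < e ->
  exists N, forall n, (N <= n)%N -> modulus (u n k - l k) < e.
have sum_small M (e : R) : 0 < e -> exists N, forall n, (N <= n)%N ->
    \sum_(k < M) modulus (((u n : nat -> K^o) - l) k) < e.
  elim: M e => [|M IH] e e0; first by exists 0 => n _; rewrite big_ord0.
  have e2 : 0 < e / 2 by rewrite divr_gt0.
  have [N1 P1] := IH _ e2; have [N2 P2] := ul M _ e2.
  exists (maxn N1 N2) => n; rewrite geq_max => /andP[n1 n2].
  by rewrite big_ord_recr/= [e]splitr ltrD ?P1 ?P2.
have bnd (e : R) : 0 < e -> exists N, forall n, (N <= n)%N ->
    forall M, pseries ((u n : nat -> K^o) - l) M <= e `^ p.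
  move=> e0; have e2 : 0 < e / 2 by rewrite divr_gt0.
  have [N uN] := cu _ e2; exists N => n Nn M.
  have [N' sN] := sum_small M _ e2.
  set m := maxn N N'.
  have -> : (u n : nat -> K^o) - l =
      ((u n : nat -> K^o) - u m) + ((u m : nat -> K^o) - l).
    by rewrite addrA subrK.
  rewrite [e]splitr; apply: pseriesD => //.
    apply: le_trans (pseries_le M (ellp_valP (u n - u m))) _.
    rewrite ge0_ler_powR ?nnegrE ?pnorm_ge0 ?(ltW p0) ?(ltW e2)//.
    apply: ltW.
    by rewrite -ellp_rnormE uN// leq_maxl.
  by apply: pseries_le_sum => //; rewrite ltW// sN// leq_maxr.
have lp : l \in ellp_pred p1.
  have [N /(_ N (leqnn _)) bN] := bnd 1 ltr01.
  rewrite -[l](subKr (u N : nat -> K^o)) rpredB ?ellp_valP//.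
  exact: ellp_bounded bN.
exists (Ellp lp) => e e0; have e2 : 0 < e / 2 by rewrite divr_gt0.
have [N uN] := bnd _ e2; exists N => n Nn.
apply: (@le_lt_trans _ _ (e / 2)); last by rewrite ltr_pdivrMr// ltr_pMr// ltr1n.
by rewrite ellp_rnormE; apply: pnorm_le (uN _ Nn); exact: ltW.
Qed.

HB.instance Definition _ := Uniform_isComplete.Build ellp
  (rcauchy_complete ellp_seq_complete).

End Ellp.

Section CZero.
Variables (R : realType) (K : scalarFieldType R).
Implicit Types (x y : nat -> K^o) (C : R).

Definition c0_pred : {pred nat -> K^o} :=
  fun x => `[< modulus (x n) @[n --> \oo] --> (0 : R) >].

Lemma c0P x : x \in c0_pred <-> forall e : R, 0 < e ->
  exists N, forall n, (N <= n)%N -> modulus (x n) < e.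
Proof.
split=> [/asboolP/cvgrPdist_lt xc e /xc[N _ xN]|xc].
  exists N => n /xN; rewrite sub0r normrN ger0_norm//; exact: modulus_ge0.
apply/asboolP/cvgrPdist_lt => e /xc[N xN]; exists N => // n /xN.
by rewrite sub0r normrN ger0_norm//; exact: modulus_ge0.
Qed.

Definition sup_norm x : R := sup (range (fun n => modulus (x n))).

Lemma c0_has_sup x : x \in c0_pred -> has_sup (range (fun n => modulus (x n))).
Proof.
move=> /c0P/(_ _ ltr01)[N xN]; split; first by exists (modulus (x 0)), 0.
exists (\sum_(k < N) modulus (x k) + 1) => _ [n _ <-].
have [nN|Nn] := ltnP n N; last first.
  rewrite (le_trans (ltW (xN _ Nn)))// lerDr sumr_ge0// => i _.
  exact: modulus_ge0.
rewrite (bigD1 (Ordinal nN))//= -addrA lerDl addr_ge0// sumr_ge0// => i _.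
exact: modulus_ge0.
Qed.

Lemma sup_norm_le x C :
  (forall n, modulus (x n) <= C) -> sup_norm x <= C.
Proof.
move=> xC; apply: ge_sup; first by exists (modulus (x 0)), 0.
by move=> _ [n _ <-].
Qed.

Lemma le_sup_norm x n : x \in c0_pred -> modulus (x n) <= sup_norm x.
Proof. by move=> xc; apply: sup_upper_bound; [exact: c0_has_sup|exists n]. Qed.

Lemma c0_approx x : (forall e : R, 0 < e ->
  exists2 y, y \in c0_pred & forall n, modulus (x n - y n) <= e) ->
  x \in c0_pred.
Proof.
move=> xy; apply/c0P => e e0; have e2 : 0 < e / 2 by rewrite divr_gt0.
have [y /c0P/(_ _ e2)[N yN] xye] := xy _ e2; exists N => n Nn.
rewrite -[x n](subrK (y n)) (le_lt_trans (ler_modulusD _ _))//.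
by rewrite [e]splitr ler_ltD ?yN.
Qed.

Fact c0_submod_closed : submod_closed c0_pred.
Proof.
split=> [|a x y xc yc].
  by apply/c0P => e e0; exists 0 => n _; rewrite modulus0.
apply/c0P => e e0; have e2 : 0 < e / 2 by rewrite divr_gt0.
have a1 : 0 < modulus a + 1 by rewrite ltr_wpDl// modulus_ge0.
have [|N xN] := (c0P x).1 xc (e / 2 / (modulus a + 1)); first by rewrite divr_gt0.
have [M yM] := (c0P y).1 yc _ e2.
exists (maxn N M) => n; rewrite geq_max => /andP[/xN xn /yM yn].
rewrite (le_lt_trans (ler_modulusD _ _))// [e]splitr ltrD//.
rewrite modulusM; rewrite ltr_pdivlMr// mulrC in xn.
apply: le_lt_trans xn; rewrite ler_wpM2r ?modulus_ge0//.
by rewrite lerDl.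
Qed.

HB.instance Definition _ :=
  GRing.isSubmodClosed.Build K (nat -> K^o) c0_pred c0_submod_closed.

Record c0 := CZero { c0_val :> nat -> K^o ; _ : c0_val \in c0_pred }.

HB.instance Definition _ := [isSub for c0_val].
HB.instance Definition _ := [Choice of c0 by <:].
HB.instance Definition _ := [SubChoice_isSubLmodule of c0 by <:].

Lemma c0_valP (x : c0) : (x : nat -> K^o) \in c0_pred.
Proof. exact: valP. Qed.

Definition c0_norm (x : c0) : R := sup_norm x.

Lemma c0_norm_ge0 (x : c0) : 0 <= c0_norm x.
Proof. exact: le_trans (modulus_ge0 _) (le_sup_norm 0 (c0_valP x)). Qed.

Lemma ler_c0_normD (x y : c0) : c0_norm (x + y) <= c0_norm x + c0_norm y.
Proof.
apply: sup_norm_le => n; rewrite (le_trans (ler_modulusD _ _))//.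
by rewrite lerD ?le_sup_norm ?c0_valP.
Qed.

Lemma c0_normZ (a : K) (x : c0) : c0_norm (a *: x) = modulus a * c0_norm x.
Proof.
apply: (@ge0_normZ _ K _ c0_norm) => [y|b y]; first exact: c0_norm_ge0.
apply: sup_norm_le => n; rewrite modulusM ler_wpM2l ?modulus_ge0//.
exact: le_sup_norm (c0_valP y).
Qed.

Lemma c0_norm0_eq0 (x : c0) : c0_norm x = 0 -> x = 0.
Proof.
move=> x0; apply/val_inj/funext => k; apply/eqP.
rewrite -(@modulus_eq0 _ K) eq_le modulus_ge0 andbT -x0 le_sup_norm//.
exact: c0_valP.
Qed.

HB.instance Definition _ := Lmodule_isNormed.Build K c0
  (ler_of_realD (K := K) ler_c0_normD) (of_realZ c0_normZ)
  (of_real_eq0 c0_norm0_eq0).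

Lemma c0_normE (x : c0) : `|x| = of_real (sup_norm x).
Proof. by []. Qed.

Lemma c0_rnormE (x : c0) : rnorm x = sup_norm x.
Proof. by rewrite /rnorm modulus_of_real// c0_norm_ge0. Qed.

Lemma c0_seq_complete (u : nat -> c0) : rcauchy u -> exists l, rcvg u l.
Proof.
move=> cu.
have ck k : exists l : K, forall e : R, 0 < e -> exists N, forall n, (N <= n)%N ->
    modulus (u n k - l) < e.
  apply: (@modulus_complete _ K (fun n => u n k)) => e /cu[N uN].
  exists N => m n Nm Nn; apply: le_lt_trans (uN _ _ Nm Nn).
  by rewrite c0_rnormE (le_sup_norm k (c0_valP (u m - u n))).
pose l k : K^o := projT1 (cid (ck k)).
have ul k := projT2 (cid (ck k)) : forall e : R, 0 < e ->
  exists N, forall n, (N <= n)%N -> modulus (u n k - l k) < e.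
have bnd (e : R) : 0 < e -> exists N, forall n, (N <= n)%N ->
    forall k, modulus (u n k - l k) <= e.
  move=> e0; have e2 : 0 < e / 2 by rewrite divr_gt0.
  have [N uN] := cu _ e2; exists N => n Nn k.
  have [N' sN] := ul k _ e2.
  set m := maxn N N'.
  have -> : u n k - l k = (u n k - u m k) + (u m k - l k) by rewrite addrA subrK.
  rewrite (le_trans (ler_modulusD _ _))// [e]splitr lerD//.
    rewrite (le_trans (le_sup_norm k (c0_valP (u n - u m))))//.
    by rewrite -c0_rnormE ltW// uN// leq_maxl.
  by rewrite ltW// sN// leq_maxr.
have lc : l \in c0_pred.
  apply: c0_approx => e /bnd[N /(_ N (leqnn _)) bN].
  by exists (u N); [exact: c0_valP|move=> n; rewrite modulusB].
exists (CZero lc) => e e0; have e2 : 0 < e / 2 by rewrite divr_gt0.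
have [N uN] := bnd _ e2; exists N => n Nn.
apply: (@le_lt_trans _ _ (e / 2)); last by rewrite ltr_pdivrMr// ltr_pMr// ltr1n.
by rewrite c0_rnormE; apply: sup_norm_le (uN _ Nn).
Qed.

HB.instance Definition _ := Uniform_isComplete.Build c0
  (rcauchy_complete c0_seq_complete).

End CZero.


Section BoundedOperators.
Variables (R : realType) (K : scalarFieldType R) (X : normedModType K).
Implicit Types f g : X -> X.

Definition bop_pred : {pred X -> X} :=
  fun f => `[< linear f /\ exists M : K, forall x, `|f x| <= M * `|x| >].

Definition opnorm f : R := sup [set rnorm (f x) | x in [set x : X | `|x| <= 1]].

Lemma bop_bound f : f \in bop_pred ->
  exists2 M : R, 0 <= M & forall x, rnorm (f x) <= M * rnorm x.
Proof.
move=> /asboolP[_ [M fM]]; exists (modulus M); first exact: modulus_ge0.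
move=> x; rewrite -(ler_of_real (s := K)) of_realM -!rnormE -normE.
apply: le_trans (fM x) _.
have [x0|x0] := eqVneq `|x| 0; first by rewrite x0 !mulr0.
have M0 : 0 <= M.
  rewrite -(@pmulr_lge0 _ `|x|); first exact: le_trans (fM x).
  by rewrite lt_neqAle eq_sym x0/=.
by rewrite (ger0_norm M0).
Qed.

Lemma bop_predP f : linear f -> (exists M : R, forall x, rnorm (f x) <= M * rnorm x) ->
  f \in bop_pred.
Proof.
move=> lf [M fM]; apply/asboolP; split=> //; exists (of_real M) => x.
by rewrite !rnormE -of_realM ler_of_real.
Qed.

Fact bop_submod_closed : submod_closed bop_pred.
Proof.
split=> [|a f g fb gb].
  apply: bop_predP => [b x y|]; first by rewrite scaler0 addr0.
  by exists 0 => x; rewrite mul0r rnorm0.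
have [/asboolP[lf _] /asboolP[lg _]] := (fb, gb).
have [M M0 fM] := bop_bound fb; have [N N0 gN] := bop_bound gb.
apply: bop_predP => [b x y|].
  have fgE z : (a *: f + g) z = a *: f z + g z by [].
  by rewrite !fgE lf lg !scalerDr !scalerA (mulrC b) addrACA.
exists (modulus a * M + N) => x; rewrite (le_trans (rnormD _ _))// mulrDl lerD//.
by rewrite rnormZ -mulrA ler_wpM2l// modulus_ge0.
Qed.

HB.instance Definition _ :=
  GRing.isSubmodClosed.Build K (X -> X) bop_pred bop_submod_closed.

(* B(X). *)
Record bop := Bop { bop_val :> X -> X ; _ : bop_val \in bop_pred }.

HB.instance Definition _ := [isSub for bop_val].
HB.instance Definition _ := [Choice of bop by <:].
HB.instance Definition _ := [SubChoice_isSubLmodule of bop by <:].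

Implicit Types T S : bop.

Lemma bop_valP T : (T : X -> X) \in bop_pred.
Proof. exact: valP. Qed.

Lemma bop_linear T : linear T.
Proof. by have /asboolP[] := bop_valP T. Qed.

Lemma bop0 T : T 0 = 0.
Proof. by have := bop_linear T (-1) 0 0; rewrite scaler0 addr0 scaleN1r addNr. Qed.

Lemma bopZ T a x : T (a *: x) = a *: T x.
Proof. by have := bop_linear T a x 0; rewrite bop0 !addr0. Qed.

Lemma opnorm_has_sup T : has_sup [set rnorm (T x) | x in [set x : X | `|x| <= 1]].
Proof.
have [M M0 TM] := bop_bound (bop_valP T).
split; first by exists (rnorm (T 0)), 0 => //=; rewrite normr0.
exists M => _ [x /= x1 <-]; rewrite (le_trans (TM x))//.
by rewrite -[leRHS]mulr1 ler_wpM2l// -rnorm_le1.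
Qed.

Lemma opnorm_ub1 T x : rnorm x <= 1 -> rnorm (T x) <= opnorm T.
Proof.
move=> x1; apply: sup_upper_bound; first exact: opnorm_has_sup.
by exists x => //=; rewrite rnorm_le1.
Qed.

Lemma opnorm_ge0 T : 0 <= opnorm T.
Proof.
apply: le_trans (opnorm_ub1 T (_ : rnorm 0 <= 1)); first exact: rnorm_ge0.
by rewrite rnorm0.
Qed.

Lemma opnormP T x : rnorm (T x) <= opnorm T * rnorm x.
Proof.
have [->|x0] := eqVneq x 0; first by rewrite bop0 rnorm0 mulr0.
have nx0 : 0 < rnorm x by rewrite lt_neqAle eq_sym rnorm_eq0 x0 rnorm_ge0.
have mV : modulus (of_real (rnorm x)^-1 : K) = (rnorm x)^-1.
  by rewrite modulus_of_real// invr_ge0 ltW.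
have := opnorm_ub1 T (_ : rnorm ((of_real (rnorm x)^-1 : K) *: x) <= 1).
rewrite bopZ !rnormZ mV mulVf ?gt_eqF// => /(_ (lexx _)).
by rewrite ler_pdivrMl// mulrC.
Qed.

Lemma opnorm_le f C : (forall x, rnorm x <= 1 -> rnorm (f x) <= C) -> opnorm f <= C.
Proof.
move=> fC; apply: ge_sup; first by exists (rnorm (f 0)), 0 => //=; rewrite normr0.
by move=> _ [x /= x1 <-]; apply: fC; rewrite -rnorm_le1.
Qed.

Lemma ler_opnormD T S : opnorm (T + S) <= opnorm T + opnorm S.
Proof.
apply: opnorm_le => x x1; rewrite (le_trans (rnormD _ _))//.
by rewrite lerD// opnorm_ub1.
Qed.

Lemma opnormZ (a : K) T : opnorm (a *: T) = modulus a * opnorm T.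
Proof.
apply: (@ge0_normZ _ K bop opnorm) => [S|b S]; first exact: opnorm_ge0.
by apply: opnorm_le => x x1; rewrite rnormZ ler_wpM2l ?modulus_ge0 ?opnorm_ub1.
Qed.

Lemma opnorm0_eq0 T : opnorm T = 0 -> T = 0.
Proof.
move=> T0; apply/val_inj/funext => x; apply/eqP.
by rewrite -rnorm_eq0 eq_le rnorm_ge0 andbT (le_trans (opnormP T x))// T0 mul0r.
Qed.

HB.instance Definition _ := Lmodule_isNormed.Build K bop
  (ler_of_realD (K := K) ler_opnormD) (of_realZ opnormZ)
  (of_real_eq0 opnorm0_eq0).

Lemma bop_normE T : `|T| = of_real (opnorm T).
Proof. by []. Qed.

Lemma bop_rnormE T : rnorm T = opnorm T.
Proof. by rewrite /rnorm modulus_of_real// opnorm_ge0. Qed.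

(* K(X). In MathComp-Analysis [precompact] means that the closure is compact. *)
Definition compop_pred : {pred bop} :=
  fun T => `[< precompact (T @` [set x : X | `|x| <= 1]) >].

Lemma precompact_lincomb (a : K) (A B C : set X) : precompact A -> precompact B ->
  (forall z, C z -> exists x y, [/\ A x, B y & z = a *: x + y]) -> precompact C.
Proof.
rewrite !precompactE => cA cB CAB; rewrite -precompactE.
pose h (z : X * X) := a *: z.1 + z.2.
have ch : compact (h @` (closure A `*` closure B)).
  apply: continuous_compact; last exact: compact_setX.
  apply: continuous_subspaceT => z.
  by apply: cvgD; [apply: cvgZr; exact: cvg_fst|exact: cvg_snd].
apply: (@precompact_subset _ _ (h @` (closure A `*` closure B))).
  move=> z /CAB[x [y [Ax By ->]]]; exists (x, y) => //.
  by split; apply: subset_closure.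
by rewrite precompact_closed//; apply: compact_closed ch; exact: norm_hausdorff.
Qed.

Fact compop_submod_closed : submod_closed compop_pred.
Proof.
split=> [|a T S /asboolP cT /asboolP cS]; apply/asboolP; last first.
  apply: (precompact_lincomb (a := a) cT cS) => _ [x /= x1 <-].
  by exists (T x), (S x); split=> //; exists x.
have c0 : compact [set (0 : X)] by exact: compact_set1.
apply: (@precompact_subset _ _ [set 0]); first by move=> _ [x _ <-].
by rewrite precompact_closed//; apply: compact_closed c0; exact: norm_hausdorff.
Qed.

HB.instance Definition _ :=
  GRing.isSubmodClosed.Build K bop compop_pred compop_submod_closed.

Definition totbnd (A : set X) := forall e : R, 0 < e ->
  exists D : seq X, forall a, A a -> exists2 d, d \in D & rnorm (d - a) < e.

Lemma precompact_totbnd A : precompact A -> totbnd A.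
Proof.
rewrite precompactE compact_cover => cA e e0.
have [|x _|D _ AD] := cA X setT (fun x => ball x (of_real e : K)).
- by move=> x _; exact: ball_open.
- by exists x => //; apply: ballxx; rewrite of_real_gt0.
exists (finmap.enum_fset D) => a /subset_closure/AD[d /= dD /rnorm_ball da].
by exists d.
Qed.

End BoundedOperators.

Section Calkin.
Variables (R : realType) (K : scalarFieldType R) (X : completeNormedModType K).
Implicit Types (T S : bop X).

Lemma totbnd_precompact (A : set X) : totbnd A -> precompact A.
Proof.
move=> tA; rewrite precompactE compact_ultra => F UF FA.
have cF : cauchy F.
  apply/cauchyP => e e0.
  have r0 : 0 < modulus e by rewrite -(of_real_gt0 K) of_real_modulus// ltW.
  have [D AD] := tA _ (divr_gt0 r0 (ltr0Sn _ 1)).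
  pose P d : set X := [set y | rnorm (d - y) < modulus e].
  have FD : F (\bigcup_(d in [set` D]) P d).
    apply: filterS FA => y cy.
    have : nbhs y [set z | rnorm (y - z) < modulus e / 2].
      by apply/nbhs_rnorm; exists (modulus e / 2) => //; rewrite divr_gt0.
    move=> /cy[a [/AD[d dD da] /= ya]]; exists d => //; rewrite /P/=.
    have -> : d - y = (d - a) + (a - y) by rewrite addrA subrK.
    by rewrite (le_lt_trans (rnormD _ _))// [ltRHS]splitr ltrD// rnormB.
  suff [d Fd] : exists d, F (P d).
    exists d; apply: filterS Fd => y; rewrite /P/= => dy.
    by rewrite -(of_real_modulus (ltW e0)); exact/rnorm_ball.
  elim: D {AD} FD => [|d D IH] FD.
    have : F set0 by apply: filterS FD => y [].
    by move=> /filter_not_empty.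
  have [Fd|Fd] := in_ultra_setVsetC (P d) UF; first by exists d.
  apply: IH; apply: filterS (filterI FD Fd) => y [[d' /=]].
  rewrite inE => /orP[/eqP -> //|d'D Pd' _]; by exists d'.
have /cvg_ex[l Fl] : cvg F by exact: cauchy_cvg.
exists l; split=> //.
suff : closure (closure A) l by rewrite -(closure_id _).1//; exact: closed_closure.
move=> B /Fl FB; have FAB : F (closure A `&` B) by exact: filterI.
exact: filter_ex FAB.
Qed.

Lemma compop_closed T : (forall e : R, 0 < e ->
  exists2 S, S \in @compop_pred _ _ X & opnorm (T - S) < e) ->
  T \in @compop_pred _ _ X.
Proof.
move=> TS; apply/asboolP/totbnd_precompact => e e0.
have e2 : 0 < e / 2 by rewrite divr_gt0.
have [S /asboolP/precompact_totbnd/(_ _ e2)[D SD] TSe] := TS _ e2.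
exists D => _ [x /= x1 <-].
have [|d dD dS] := SD (S x); first by exists x.
exists d => //; have -> : d - T x = (d - S x) + (S x - T x) by rewrite addrA subrK.
rewrite (le_lt_trans (rnormD _ _))// [e]splitr ltrD// rnormB.
apply: le_lt_trans TSe; apply: (opnorm_ub1 (T - S)); by rewrite -rnorm_le1.
Qed.

(* B(X)/K(X). *)
Definition calkin : Type := Quotient.quot (@compop_pred _ _ X).

HB.instance Definition _ := GRing.Zmodule.on calkin.
HB.instance Definition _ := EqQuotient.on calkin.

Implicit Types A B : calkin.
Local Open Scope quotient_scope.

Lemma calkin_piE T S :
  (\pi_calkin T = \pi_calkin S) <-> T - S \in @compop_pred _ _ X.
Proof.
by rewrite Quotient.idealrBE; split=> [/eqP|/eqP].
Qed.

Lemma calkin_piD T S : \pi_calkin (T + S) = \pi_calkin T + \pi_calkin S.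
Proof. exact: Quotient.pi_add. Qed.

Lemma calkin_pi0 : \pi_calkin 0 = 0 :> calkin.
Proof.
have /eqP := calkin_piD 0 0.
by rewrite addr0 -subr_eq0 opprD addNKr oppr_eq0 => /eqP.
Qed.

Definition calkin_scale (a : K) A : calkin := \pi_calkin (a *: repr A).

Lemma calkin_piZ a T : calkin_scale a (\pi_calkin T) = \pi_calkin (a *: T).
Proof.
apply/calkin_piE; rewrite -scalerBr rpredZ//.
by apply/calkin_piE; rewrite reprK.
Qed.

Lemma calkinP A : exists T, A = \pi_calkin T.
Proof. by exists (repr A); rewrite reprK. Qed.

Fact calkin_scaleA a b A :
  calkin_scale a (calkin_scale b A) = calkin_scale (a * b) A.
Proof. by have [T ->] := calkinP A; rewrite !calkin_piZ scalerA. Qed.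

Fact calkin_scale1 : left_id 1 calkin_scale.
Proof. by move=> A; have [T ->] := calkinP A; rewrite calkin_piZ scale1r. Qed.

Fact calkin_scaleDr : right_distributive calkin_scale +%R.
Proof.
move=> a A B; have [T ->] := calkinP A; have [S ->] := calkinP B.
by rewrite -calkin_piD !calkin_piZ scalerDr calkin_piD.
Qed.

Fact calkin_scaleDl A : {morph calkin_scale^~ A : a b / a + b}.
Proof.
move=> a b; have [T ->] := calkinP A.
by rewrite !calkin_piZ scalerDl calkin_piD.
Qed.

HB.instance Definition _ := GRing.Zmodule_isLmodule.Build K calkin
  calkin_scaleA calkin_scale1 calkin_scaleDr calkin_scaleDl.

Definition calkin_norm A : R := inf [set opnorm T | T in [set T | \pi_calkin T = A]].

Lemma calkin_norm_le T : calkin_norm (\pi_calkin T) <= opnorm T.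
Proof.
apply: ge_inf; last by exists T.
by exists 0 => _ [S _ <-]; exact: opnorm_ge0.
Qed.

Lemma calkin_has_inf A : has_inf [set opnorm T | T in [set T | \pi_calkin T = A]].
Proof.
split; first by have [T ->] := calkinP A; exists (opnorm T), T.
by exists 0 => _ [S _ <-]; exact: opnorm_ge0.
Qed.

Lemma calkin_norm_adherent A (e : R) : 0 < e ->
  exists2 T, \pi_calkin T = A & opnorm T < calkin_norm A + e.
Proof.
by move=> e0; have [_ [T TA <-] Te] := inf_adherent e0 (calkin_has_inf A); exists T.
Qed.

Lemma calkin_norm_ge0 A : 0 <= calkin_norm A.
Proof.
apply: lb_le_inf; first by have [] := calkin_has_inf A.
by move=> _ [T _ <-]; exact: opnorm_ge0.
Qed.

Lemma ler_calkin_normD A B : calkin_norm (A + B) <= calkin_norm A + calkin_norm B.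
Proof.
apply/ler_addgt0Pr => e e0; have e2 : 0 < e / 2 by rewrite divr_gt0.
have [T TA Te] := calkin_norm_adherent A e2.
have [S SB Se] := calkin_norm_adherent B e2.
rewrite -TA -SB -calkin_piD (le_trans (calkin_norm_le _))// TA SB.
rewrite (le_trans (ler_opnormD _ _))// [e]splitr addrACA.
by rewrite lerD// ltW.
Qed.

Lemma calkin_normZ (a : K) A : calkin_norm (a *: A) = modulus a * calkin_norm A.
Proof.
apply: (@ge0_normZ _ K calkin calkin_norm) => [B|b B]; first exact: calkin_norm_ge0.
apply/ler_addgt0Pr => e e0.
have b1 : 0 < modulus b + 1 by rewrite ltr_wpDl// modulus_ge0.
have [T TB Te] := calkin_norm_adherent B (divr_gt0 e0 b1).
rewrite -[in leLHS]TB [_ *: _]calkin_piZ (le_trans (calkin_norm_le _))// opnormZ.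
apply: (@le_trans _ _ (modulus b * (calkin_norm B + e / (modulus b + 1)))).
  by rewrite ler_wpM2l ?modulus_ge0 ?ltW.
rewrite mulrDr lerD2l mulrCA -[leRHS]mulr1 ler_wpM2l ?(ltW e0)//.
by rewrite ler_pdivrMr// mul1r lerDl.
Qed.

Lemma calkin_norm0_eq0 A : calkin_norm A = 0 -> A = 0.
Proof.
have [T ->] := calkinP A => T0; rewrite -calkin_pi0; apply/calkin_piE.
rewrite subr0; apply: compop_closed => e e0.
have [S /calkin_piE ST Se] := calkin_norm_adherent (\pi_calkin T) e0.
rewrite T0 add0r in Se.
exists (T - S); last by rewrite subKr.
by rewrite -opprB rpredN.
Qed.

HB.instance Definition _ := Lmodule_isNormed.Build K calkin
  (ler_of_realD (K := K) ler_calkin_normD) (of_realZ calkin_normZ)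
  (of_real_eq0 calkin_norm0_eq0).

Lemma calkin_normE A : `|A| = of_real (calkin_norm A).
Proof. by []. Qed.

End Calkin.

(* Radii are in K so that [ball] applies; 0 < r n forces them to be real. *)
Definition BCP (K : numFieldType) (Y : normedModType K) : Prop :=
  exists (y : nat -> Y) (r : nat -> K), [/\ forall n, 0 < r n,
    [set x : Y | `|x| = 1] `<=` \bigcup_n ball (y n) (r n) &
    forall n, ~ ball (y n) (r n) 0].

(* Main.v *)
(* Let T_n represent the centres y_n. As I - P_N differs from the identity by a
   finite-rank operator, arbitrarily far out there are finite blocks F of
   coordinates with ||P_F T_n x|| close to ||y_n|| for some x in the unit ball.
   Choose successive blocks serving every n infinitely often and leaving an
   infinite set A of coordinates unused. The class of P_A has norm 1, and
   P_F (T_n - P_A) = P_F T_n on each block, while P_F S -> 0 in norm for compact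
   S as F moves to infinity; so ||y_n - [P_A]|| >= ||y_n||, and no ball avoiding 0
   contains [P_A]. Compressing on the left makes this work for l^1 too: K P_N need
   not tend to K there, but P_N K does. *)
Require Import Defs.
From mathcomp Require Import all_boot all_order all_algebra.
From mathcomp Require Import complex lra.
From mathcomp Require Import all_classical all_reals all_analysis.
Set Implicit Arguments.
Unset Strict Implicit.
Unset Printing Implicit Defensive.
Import Order.TTheory GRing.Theory Num.Theory.
Import numFieldNormedType.Exports.
Local Open Scope classical_set_scope.
Local Open Scope ring_scope.

(** Local compactness of the scalars in metric form; it makes bounded operators into a coordinate
    line compact. *)
Definition scalar_totbnd {R : realType} (K : scalarFieldType R) : Prop :=
  forall C e : R, 0 < e -> exists D : seq K, forall a, modulus a <= C ->
    exists2 d, d \in D & modulus (d - a) < e.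

(* P F is the projection onto the coordinates in F of a 1-unconditional basis b. *)
Record coord_proj {R : realType} {K : scalarFieldType R} {X : normedModType K}
    (P : (nat -> bool) -> X -> X) (b : nat -> X) : Prop := CoordProj {
  cproj_linear : forall F, linear (P F) ;
  cproj_contr : forall F x, rnorm (P F x) <= rnorm x ;
  cproj_comp : forall F G x, P F (P G x) = P (fun k => F k && G k) x ;
  cproj_predT : forall x, P xpredT x = x ;
  cproj_predC : forall F x, P (fun k => ~~ F k) x = x - P F x ;
  cproj_tail : forall x (e : R), 0 < e -> exists N, rnorm (P (leq N) x) < e ;
  cproj_coord : forall k x, exists a : K, P (pred1 k) x = a *: b k ;
  cproj_basis : forall k, P (pred1 k) (b k) = b k ;
  rnorm_basis : forall k, rnorm (b k) = 1 }.

(** * The quotient norm tested on blocks of coordinates *)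

Section CalkinCoordProj.
Context {R : realType} {K : scalarFieldType R} {X : completeNormedModType K}.
Context {P : (nat -> bool) -> X -> X} {b : nat -> X}.
Hypotheses (cP : coord_proj P b) (Ktb : scalar_totbnd K).
Implicit Types (F G : nat -> bool) (x y : X) (S T : bop X).
Local Open Scope quotient_scope.

Lemma cproj_bop_subproof F : P F \in @bop_pred _ _ X.
Proof.
apply: bop_predP; first exact: cproj_linear cP F.
by exists 1 => x; rewrite mul1r (cproj_contr cP).
Qed.

Definition cprojb F : bop X := Bop (cproj_bop_subproof F).

Lemma bop_comp_subproof S T : (fun x => S (T x)) \in @bop_pred _ _ X.
Proof.
apply: bop_predP => [a x y|]; first by rewrite !bop_linear.
exists (opnorm S * opnorm T) => x.
by rewrite (le_trans (opnormP S _))// -mulrA ler_wpM2l ?opnorm_ge0 ?opnormP.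
Qed.

Definition bop_comp S T : bop X := Bop (bop_comp_subproof S T).

Lemma cprojB F x y : P F (x - y) = P F x - P F y.
Proof.
by rewrite [x - y]addrC -scaleN1r (cproj_linear cP) scaleN1r addrC.
Qed.

Lemma cproj_eq F G x : F =1 G -> P F x = P G x.
Proof. by move=> /funext ->. Qed.

Lemma cproj_subset F G x : (forall k, F k -> G k) -> P F (P G x) = P F x.
Proof.
move=> FG; rewrite (cproj_comp cP); apply: cproj_eq => k.
by case: (boolP (F k)) => // /FG ->.
Qed.

Lemma cproj_disjoint F G x : (forall k, F k -> ~~ G k) -> P F (P G x) = 0.
Proof.
move=> FG; apply/esym/eqP; rewrite -subr_eq0 sub0r oppr_eq0; apply/eqP.
(* The set [~~ true] is empty: its projection is the identity minus [P xpredT], which is 0. *)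
have -> : P F (P G x) = P (fun k => ~~ true) x.
  rewrite (cproj_comp cP); apply: cproj_eq => k.
  by case: (boolP (F k)) => // /FG /negbTE.
by rewrite (cproj_predC cP) (cproj_predT cP) subrr.
Qed.

Lemma rnorm_cproj_subset F G x : (forall k, F k -> G k) -> rnorm (P F x) <= rnorm (P G x).
Proof. by move=> FG; rewrite -(cproj_subset x FG) (cproj_contr cP). Qed.

(** The image of the unit ball is a bounded part of the line of [b k], so a finite net of scalars
    yields a finite net of vectors. *)
Lemma compop_coord T k : bop_comp (cprojb (pred1 k)) T \in @compop_pred _ _ X.
Proof.
apply/asboolP/totbnd_precompact => e /(Ktb (opnorm T))[D TD].
exists [seq d *: b k | d <- D] => _ [x /= x1 <-].
have [a Ea] := cproj_coord cP k (T x).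
have [d dD da] : exists2 d, d \in D & modulus (d - a) < e.
  apply: TD; rewrite -[leLHS]mulr1 -(rnorm_basis cP k) -rnormZ -Ea.
  by rewrite (le_trans (cproj_contr cP _ _))// opnorm_ub1// -rnorm_le1.
exists (d *: b k); first exact: map_f.
by rewrite Ea -scalerBl rnormZ (rnorm_basis cP) mulr1.
Qed.

(** Coordinates are removed one at a time, each at the cost of a compact operator; hence [T] and its
    tail have the same class. *)
Lemma compop_tail T N : T - bop_comp (cprojb (leq N)) T \in @compop_pred _ _ X.
Proof.
elim: N => [|N IH].
  suff -> : bop_comp (cprojb (leq 0)) T = T by rewrite subrr rpred0.
  by apply/val_inj/funext => x /=; exact: (cproj_predT cP).
have -> : T - bop_comp (cprojb (leq N.+1)) T =
  (T - bop_comp (cprojb (leq N)) T) + bop_comp (cprojb (pred1 N)) T.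
  apply/val_inj/funext => x /=.
  change (T x - P (leq N.+1) (T x) = T x - P (leq N) (T x) + P (pred1 N) (T x)).
  rewrite -addrA; congr (_ + _); rewrite addrC -opprB; congr (- _).
  have -> : P (leq N.+1) (T x) = P (fun k => ~~ pred1 N k) (P (leq N) (T x)).
    rewrite (cproj_comp cP); apply: cproj_eq => k /=.
    by rewrite ltn_neqAle eq_sym.
  by rewrite (cproj_predC cP) cproj_subset// => k /= /eqP ->.
by rewrite rpredD// compop_coord.
Qed.

Lemma tail_lt_seq (D : seq X) (e : R) : 0 < e ->
  exists N, forall d, d \in D -> rnorm (P (leq N) d) < e.
Proof.
move=> e0; elim: D => [|d D [N NP]]; first by exists 0.
have [M MP] := cproj_tail cP d e0; exists (maxn N M) => d'.
rewrite inE => /predU1P[->|/NP d'e].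
  by apply: le_lt_trans MP; apply: rnorm_cproj_subset => k; rewrite geq_max => /andP[].
by apply: le_lt_trans d'e; apply: rnorm_cproj_subset => k; rewrite geq_max => /andP[].
Qed.

(** Tails tend to 0 pointwise and projections are contractions, so on a totally bounded set the
    convergence is uniform. *)
Lemma compop_tail_small S (e : R) : S \in @compop_pred _ _ X -> 0 < e ->
  exists N, forall x, rnorm x <= 1 -> rnorm (P (leq N) (S x)) < e.
Proof.
move=> /asboolP/precompact_totbnd tS e0.
have e2 : 0 < e / 2 by rewrite divr_gt0.
have [D SD] := tS _ e2; have [N NP] := tail_lt_seq D e2.
exists N => x x1; have [|d dD dS] := SD (S x).
  by exists x => //=; rewrite rnorm_le1.
rewrite -[S x](subKr d) cprojB (le_lt_trans (rnormD _ _))// rnormN [e]splitr.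
by rewrite ltrD//; [exact: NP|exact: le_lt_trans (cproj_contr cP _ _) dS].
Qed.

(* A compact perturbation is negligible on blocks of coordinates far enough out. *)
Lemma calkin_norm_ge T (C : R) :
  (forall N (e : R), 0 < e -> exists F x, [/\ forall k, F k -> (N <= k)%N,
    rnorm x <= 1 & C - e < rnorm (P F (T x))]) ->
  C <= calkin_norm (\pi_(calkin X) T).
Proof.
move=> TC; apply: lb_le_inf; first by have [] := calkin_has_inf (\pi_(calkin X) T).
move=> _ [S /calkin_piE ST <-]; apply/ler_addgt0Pr => e e0.
(* [S] is any representative: half of [e] is lost in the choice of the block, half on the compact
   operator [S - T]. *)
have e2 : 0 < e / 2 by rewrite divr_gt0.
have [N NP] := compop_tail_small ST e2.
have [F [x [FN x1 Fx]]] := TC N _ e2.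
have TE : T x = S x - (S - T) x by rewrite (_ : (S - T) x = S x - T x)// subKr.
have h1 : rnorm (P F (T x)) <= rnorm (P F (S x)) + rnorm (P F ((S - T) x)).
  by rewrite TE cprojB (le_trans (rnormD _ _))// rnormN.
have h2 : rnorm (P F (S x)) <= opnorm S.
  by rewrite (le_trans (cproj_contr cP _ _))// opnorm_ub1.
have h3 : rnorm (P F ((S - T) x)) < e / 2.
  by apply: le_lt_trans (NP _ x1); exact: rnorm_cproj_subset.
lra.
Qed.

(** Dropping the coordinates before [N] keeps the class, so the operator norm of what remains is at
    least the quotient norm; a nearly extremal image is then cut at [M], past which it is small. *)
Lemma calkin_norm_block T N (e : R) : 0 < e -> exists M x, rnorm x <= 1 /\
  calkin_norm (\pi_(calkin X) T) - e < rnorm (P (fun k => N <= k < M)%N (T x)).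
Proof.
move=> e0; have e2 : 0 < e / 2 by rewrite divr_gt0.
set C := calkin_norm _; pose S := bop_comp (cprojb (leq N)) T.
have CS : C <= opnorm S.
  rewrite /C (_ : \pi_(calkin X) T = \pi_(calkin X) S) ?calkin_norm_le//.
  by apply/calkin_piE; exact: compop_tail.
have [_ [x /= x1 <-] Sx] := sup_adherent e2 (opnorm_has_sup S).
have [M MP] := cproj_tail cP (S x) e2.
exists M, x; rewrite -rnorm_le1; split=> //.
have -> : P (fun k => N <= k < M)%N (T x) = S x - P (leq M) (S x).
  rewrite -(cproj_predC cP) /S/= (cproj_comp cP); apply: cproj_eq => k.
  by rewrite -ltnNge andbC.
have : rnorm (S x) <= rnorm (S x - P (leq M) (S x)) + rnorm (P (leq M) (S x)).
  by rewrite -[in leLHS](subrK (P (leq M) (S x)) (S x)) rnormD.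
move: Sx; rewrite -/(opnorm S); lra.
Qed.

(** Widening a window only raises the projected norm, so one window serves finitely many operators.
    The strict [N < k] keeps coordinate [N] free. *)
Lemma calkin_norm_blocks (T : nat -> bop X) n N (e : R) : 0 < e ->
  exists2 M, (N < M)%N & forall i, (i < n)%N -> exists2 x, rnorm x <= 1 &
    calkin_norm (\pi_(calkin X) (T i)) - e < rnorm (P (fun k => N < k < M)%N (T i x)).
Proof.
move=> e0; elim: n => [|n [M NM IH]]; first by exists N.+1.
have [M' [x [x1 xP]]] := calkin_norm_block (T n) N.+1 e0.
exists (maxn M M'); first by rewrite leq_max NM.
move=> i; rewrite ltnS leq_eqVlt => /predU1P[->|/IH[y y1 yP]].
  exists x => //; apply: lt_le_trans xP _; apply: rnorm_cproj_subset => k.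
  by rewrite leq_max => /andP[-> ->]; rewrite orbT.
exists y => //; apply: lt_le_trans yP _; apply: rnorm_cproj_subset => k.
by rewrite leq_max => /andP[-> ->].
Qed.

(** Every operator is served by all late blocks, with error tending to 0, while the endpoints [m j]
    belong to no block. *)
Lemma calkin_block_seq (T : nat -> bop X) : exists m : nat -> nat,
  {homo m : i j / (i < j)%N} /\ forall i j, (i <= j)%N -> exists2 x, rnorm x <= 1 &
    calkin_norm (\pi_(calkin X) (T i)) - j.+1%:R^-1 <
      rnorm (P (fun k => m j < k < m j.+1)%N (T i x)).
Proof.
have j0 j : 0 < j.+1%:R^-1 :> R by rewrite invr_gt0.
pose step j N := cid2 (calkin_norm_blocks T j.+1 N (j0 j)).
pose m := fix m j := if j is j'.+1 then s2val (step j' (m j')) else 0%N.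
exists m; split; first by apply: homo_ltn => [? ? ?|j]; [exact: ltn_trans|exact: (s2valP (step j (m j)))].
by move=> i j ij; apply: (s2valP' (step j (m j))).
Qed.

Theorem not_BCP_calkin : ~ BCP (calkin X).
Proof.
move=> [y [r [r0 yr y0]]].
pose T n : bop X := repr (y n).
have Ty n : \pi_(calkin X) (T n) = y n by exact: reprK.
have [m [mS mT]] := calkin_block_seq T.
have m_ge j : (j <= m j)%N.
  by elim: j => // j IH; apply: leq_ltn_trans IH (mS _ _ _).
(* [A] collects the endpoints: infinitely many coordinates outside all blocks. *)
pose A k := `[< exists j, k = m j >].
have blockA j k : (m j < k < m j.+1)%N -> ~~ A k.
  move=> /andP[jk kj]; apply/asboolP => -[i ki]; move: jk kj; rewrite ki.
  by rewrite !(leqW_mono (leq_mono mS)) ltnS => ji /(leq_trans ji); rewrite ltnn.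
pose Q := cprojb A.
have Q1 : calkin_norm (\pi_(calkin X) Q) = 1.
  apply/eqP; rewrite eq_le; apply/andP; split.
    rewrite (le_trans (calkin_norm_le _))//; apply: opnorm_le => x x1.
    exact: le_trans (cproj_contr cP _ _) x1.
  (* The coordinate [m N] lies in [A] and is at least [N], so its basis vector witnesses norm 1
     arbitrarily far out. *)
  apply: calkin_norm_ge => N e e0; exists (pred1 (m N)), (b (m N)).
  rewrite (rnorm_basis cP); split=> // [k /eqP ->//|].
  rewrite cproj_subset => [|k /eqP ->]; last by apply/asboolP; exists N.
  by rewrite (cproj_basis cP) (rnorm_basis cP) ltrBlDr ltrDl.
have [|n _] := yr (\pi_(calkin X) Q).
  by rewrite /= calkin_normE Q1 of_real1.
(* Once the norm of [y n] is at most its distance to the class of [Q], a ball containing that class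
   also contains 0. *)
rewrite -ball_normE /ball_/= => yQ; apply: (y0 n).
rewrite -ball_normE /ball_/= subr0; apply: le_lt_trans yQ.
have -> : y n - \pi_(calkin X) Q = \pi_(calkin X) (T n - Q).
  by apply/eqP; rewrite subr_eq -calkin_piD subrK Ty.
rewrite -Ty !calkin_normE ler_of_real.
apply: calkin_norm_ge => N e e0.
have [J _ JP] := near_infty_natSinv_lt (PosNum e0).
(* [j >= n] lets block [j] serve [T n], [j >= N] puts it beyond [N], and [j >= J] makes its error
   less than [e]. *)
pose j := maxn n (maxn N J).
have [x x1 xP] := mT n j (leq_maxl _ _).
exists (fun k => m j < k < m j.+1)%N, x; split=> // [k /andP[jk _]|].
  apply: leq_trans (ltnW jk); apply: leq_trans (m_ge j).
  by rewrite /j !leq_max leqnn orbT.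
have -> : (T n - Q) x = T n x - P A x by [].
(* On the block the projection onto [A] vanishes, so only [T n] is seen. *)
rewrite cprojB (cproj_disjoint _ (blockA j)) subr0; apply: lt_trans xP.
by rewrite ltrD2l ltrN2; apply: JP; rewrite /= /j !leq_max leqnn !orbT.
Qed.

End CalkinCoordProj.

(** * Restriction of raw sequences to sets of coordinates, shared by both kinds of spaces *)

Definition coord_restr {R : realType} {K : scalarFieldType R} (F : nat -> bool)
  (x : nat -> K^o) : nat -> K^o := fun k => if F k then x k else 0.

Section CoordRestr.
Context {R : realType} {K : scalarFieldType R}.
Implicit Types (F G : nat -> bool) (x y : nat -> K^o).

Lemma coord_restr_linear F : linear (@coord_restr R K F).
Proof.
move=> a x y; apply/funext => k; rewrite /coord_restr !fctE.
by case: ifP => // _; rewrite scaler0 addr0.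
Qed.

Lemma coord_restr_comp F G x :
  coord_restr F (coord_restr G x) = coord_restr (fun k => F k && G k) x.
Proof. by apply/funext => k; rewrite /coord_restr; case: (F k). Qed.

Lemma coord_restr_predC F x :
  coord_restr (fun k => ~~ F k) x = x - coord_restr F x.
Proof.
apply/funext => k; rewrite !fctE /coord_restr.
by case: (F k); rewrite ?subrr ?subr0.
Qed.

Lemma coord_restr_pred1 k x :
  coord_restr (pred1 k) x = x k *: coord_restr (pred1 k) (fun=> 1).
Proof.
apply/funext => i; rewrite !fctE /coord_restr /=.
by case: eqP => [->|_]; rewrite ?scaler0// [RHS]mulr1.
Qed.

Lemma modulus_coord_restr F x k : modulus (coord_restr F x k) <= modulus (x k).
Proof. by rewrite /coord_restr; case: ifP => // _; rewrite modulus0 modulus_ge0. Qed.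

End CoordRestr.

(** * Coordinate projections on [ellp] *)

Section EllpCoord.
Context {R : realType} {K : scalarFieldType R} {p : R} {p1 : 1 <= p}.
(* MathComp-Analysis has power series of the same name. *)
Local Notation pseries := (@Defs.pseries R K p).

Let p0 : 0 < p. Proof. exact: lt_le_trans p1. Qed.

Lemma pseries_coord_restr (F : nat -> bool) (x : nat -> K^o) n :
  pseries (coord_restr F x) n <= pseries x n.
Proof.
rewrite /pseries !seriesEord/=; apply: ler_sum => k _.
by rewrite ge0_ler_powR ?nnegrE ?modulus_ge0 ?(ltW p0)// modulus_coord_restr.
Qed.

Lemma pseries_basis (x : nat -> K^o) k n :
  pseries (coord_restr (pred1 k) x) n <= modulus (x k) `^ p.
Proof.
rewrite /pseries seriesEord/=; case: (ltnP k n) => kn; last first.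
  rewrite big1 ?powR_ge0// => i _; rewrite /coord_restr/=.
  by rewrite ltn_eqF ?modulus0 ?powR0 ?gt_eqF// (leq_trans _ kn).
rewrite (bigD1 (Ordinal kn))//= big1 ?addr0 => [|i].
  by rewrite /coord_restr/= eqxx.
rewrite -val_eqE/= /coord_restr/= => /negPf ->.
by rewrite modulus0 powR0// gt_eqF.
Qed.

Lemma ellp_coord_restr_subproof F (x : ellp K p1) : coord_restr F x \in ellp_pred p1.
Proof.
apply: (@ellp_bounded _ _ _ p1 _ (pnorm p x `^ p)) => n.
by rewrite (le_trans (pseries_coord_restr _ _ _))// pseries_le ?ellp_valP.
Qed.

Definition ellp_proj F (x : ellp K p1) : ellp K p1 := Ellp (ellp_coord_restr_subproof F x).

Lemma ellp_basis_subproof k : coord_restr (pred1 k) (fun=> 1 : K^o) \in ellp_pred p1.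
Proof.
apply: (@ellp_bounded _ _ _ p1 _ (modulus (1 : K) `^ p)) => n.
exact: pseries_basis.
Qed.

Definition ellp_basis k : ellp K p1 := Ellp (ellp_basis_subproof k).

Lemma ellp_coord_proj : coord_proj ellp_proj ellp_basis.
Proof.
split=> [F a x y|F x|F G x|x|F x|x e e0|k x|k|k].
- exact/val_inj/coord_restr_linear.
- rewrite !ellp_rnormE; apply: (pnorm_le p1); first exact: pnorm_ge0.
  move=> n; rewrite (le_trans (pseries_coord_restr _ _ _))//.
  by rewrite pseries_le ?ellp_valP.
- exact/val_inj/coord_restr_comp.
- exact/val_inj.
- exact/val_inj/coord_restr_predC.
(* Halving [e] makes up for the non-strict bound of [pnorm_le]; the series of the tail is bounded by
   the limit minus the partial sum up to [N]. *)
- have e2 : 0 < e / 2 by rewrite divr_gt0.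
  have /asboolP xp := ellp_valP x.
  move/cvgrPdist_le/(_ _ (powR_gt0 p e2)): xp => [N _ NP].
  exists N; apply: (@le_lt_trans _ _ (e / 2)); last by lra.
  rewrite ellp_rnormE; apply: (pnorm_le p1) (ltW e2) _ => n.
  have /(le_trans (ler_norm _)) := NP N (leqnn N); apply: le_trans.
  (* [maxn n N] lets the sum be split at [N] whatever [n] is. *)
  apply: (@le_trans _ _ (pseries x (maxn n N) - pseries x N)); last first.
    by rewrite lerD2r pseries_le_lim ?ellp_valP.
  apply: (@le_trans _ _ (pseries (ellp_proj (leq N) x) (maxn n N))).
    by apply: pseries_nondecreasing; rewrite leq_maxl.
  rewrite lerBrDr /pseries !seriesEnat/=.
  rewrite !(@big_cat_nat _ _ _ N 0 (maxn n N))//= ?leq_maxr//.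
  rewrite big_nat big1 ?add0r => [|i /andP[_ iN]]; last first.
    by rewrite /coord_restr leqNgt iN modulus0 powR0// gt_eqF.
  rewrite [leRHS]addrC lerD2r; apply: ler_sum => i _.
  by rewrite ge0_ler_powR ?nnegrE ?modulus_ge0 ?(ltW p0)// modulus_coord_restr.
- by exists (x k); exact/val_inj/coord_restr_pred1.
- apply/val_inj; rewrite /= coord_restr_comp; congr coord_restr.
  by apply/funext => i; rewrite andbb.
- rewrite ellp_rnormE; apply/eqP; rewrite eq_le; apply/andP; split.
    by apply: (pnorm_le p1) => // n; rewrite -(modulus1 K) pseries_basis.
  rewrite -(modulus1 K); apply: le_trans (pnorm_coord k (ellp_valP _)).
  by rewrite /= /coord_restr/= eqxx.
Qed.

End EllpCoord.

(** * Coordinate projections on [c0] *)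

Section CZeroCoord.
Context {R : realType} {K : scalarFieldType R}.

Lemma c0_coord_restr_subproof F (x : c0 K) : coord_restr F x \in @c0_pred R K.
Proof.
apply/c0P => e /((c0P x).1 (c0_valP x))[N NP]; exists N => n /NP.
exact/le_lt_trans/modulus_coord_restr.
Qed.

Definition c0_proj F (x : c0 K) : c0 K := CZero (c0_coord_restr_subproof F x).

Lemma c0_basis_subproof k : coord_restr (pred1 k) (fun=> 1 : K^o) \in @c0_pred R K.
Proof.
apply/c0P => e e0; exists k.+1 => n kn.
by rewrite /coord_restr/= gtn_eqF// modulus0.
Qed.

Definition c0_basis k : c0 K := CZero (c0_basis_subproof k).

Lemma c0_coord_proj : coord_proj c0_proj c0_basis.
Proof.
split=> [F a x y|F x|F G x|x|F x|x e e0|k x|k|k].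
- exact/val_inj/coord_restr_linear.
- rewrite !c0_rnormE; apply: sup_norm_le => n.
  exact: le_trans (modulus_coord_restr _ _ _) (le_sup_norm _ (c0_valP x)).
- exact/val_inj/coord_restr_comp.
- exact/val_inj.
- exact/val_inj/coord_restr_predC.
- have e2 : 0 < e / 2 by rewrite divr_gt0.
  have [N NP] := (c0P x).1 (c0_valP x) _ e2.
  exists N; apply: (@le_lt_trans _ _ (e / 2)); last by lra.
  rewrite c0_rnormE; apply: sup_norm_le => n; rewrite /= /coord_restr.
  by case: ifP => [/NP/ltW//|_]; rewrite modulus0 ltW.
- by exists (x k); exact/val_inj/coord_restr_pred1.
- apply/val_inj; rewrite /= coord_restr_comp; congr coord_restr.
  by apply/funext => i; rewrite andbb.
- rewrite c0_rnormE; apply/eqP; rewrite eq_le; apply/andP; split.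
    apply: sup_norm_le => n; apply: le_trans (modulus_coord_restr _ _ _) _.
    by rewrite modulus1.
  rewrite -(modulus1 K); apply: le_trans (le_sup_norm k (c0_valP _)).
  by rewrite /= /coord_restr/= eqxx.
Qed.

End CZeroCoord.

(** * Total boundedness of bounded sets of real and complex scalars *)

Lemma real_scalar_totbnd (R : realType) : scalar_totbnd (R : scalarFieldType R).
Proof.
(* The net is a grid of mesh [e] starting at [- C]; rounding [a] down needs an index of at most
   [2 * C / e]. *)
move=> C e e0; pose N := (Num.truncn (2 * C / e)).+1.
exists [seq i%:R * e - C | i <- iota 0 N] => a; change (`|a| <= C ->
  exists2 d, d \in [seq i%:R * e - C | i <- iota 0 N] & `|d - a| < e).
rewrite ler_norml => /andP[Ca aC].
have ae0 : 0 <= (a + C) / e by rewrite divr_ge0 ?(ltW e0)//; lra.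
have /andP[le_i lt_i] := truncn_itv ae0.
set i := Num.truncn _ in le_i lt_i.
exists (i%:R * e - C).
  apply/mapP; exists i; rewrite // mem_iota/= add0n ltnS le_truncn//.
  by rewrite ler_pM2r ?invr_gt0//; lra.
move: le_i lt_i; rewrite ler_pdivlMr// ltr_pdivrMr// -natr1 mulrDl mul1r.
by rewrite ltr_norml => ? ?; apply/andP; split; lra.
Qed.

(** Real nets with tolerance [e / 2] for both parts suffice, since twice the square of [e / 2] is
    below the square of [e]. *)
Lemma complex_scalar_totbnd (R : realType) : scalar_totbnd (R[i] : scalarFieldType R).
Proof.
move=> C e e0; have e2 : 0 < e / 2 by rewrite divr_gt0.
have [D DP] := @real_scalar_totbnd R C (e / 2) e2.
exists [seq (x +i* y)%C | x <- D, y <- D] => -[a b] abC.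
have le_sqrt (x y : R) : `|x| <= Num.sqrt (x ^+ 2 + y ^+ 2).
  by rewrite -sqrtr_sqr ler_sqrt ?addr_ge0 ?sqr_ge0// lerDl sqr_ge0.
have [x xD xa] := DP a (le_trans (le_sqrt a b) abC).
have [|y yD yb] := DP b; first by apply: le_trans abC; rewrite /modulus/= addrC.
exists (x +i* y)%C; first exact: allpairs_f.
rewrite -[modulus _]/(Num.sqrt ((x - a) ^+ 2 + (y - b) ^+ 2)).
rewrite -[e]ger0_norm ?(ltW e0)// -sqrtr_sqr ltr_sqrt ?exprn_gt0//.
move: xa yb.
rewrite -[modulus (x - a)]/(`|x - a|) -[modulus (y - b)]/(`|y - b|) !ltr_norml => /andP[? ?] /andP[? ?].
nra.
Qed.

Theorem corollary2p6 (R : realType) :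
  ((forall (p : R) (p1 : 1 <= p),
      ~ BCP (calkin (ellp (R : scalarFieldType R) p1))) /\
    ~ BCP (calkin (c0 (R : scalarFieldType R)))) /\
  ((forall (p : R) (p1 : 1 <= p),
      ~ BCP (calkin (ellp (R[i] : scalarFieldType R) p1))) /\
    ~ BCP (calkin (c0 (R[i] : scalarFieldType R)))).
Proof.
have [rK cK] := (@real_scalar_totbnd R, @complex_scalar_totbnd R).
split; split=> [p p1|].
- exact: not_BCP_calkin (ellp_coord_proj (p1 := p1)) rK.
- exact: not_BCP_calkin c0_coord_proj rK.
- exact: not_BCP_calkin (ellp_coord_proj (p1 := p1)) cK.
- exact: not_BCP_calkin c0_coord_proj cK.
Qed.
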